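(* Let $G=(V,E)$ be a finite simple graph, and let $\sigma=(v_1,\dots,v_m)$ be a preordering of $G$ (a sequence of $m$ distinct vertices of $G$). (1) If $m$ is even, then $\sigma\text{-}\mathrm{gcol}(G)\le \sigma\text{-}\mathrm{gcol}_B(G)$. (2) If $m$ is odd, then $\sigma\text{-}\mathrm{gcol}_A(G)\le \sigma\text{-}\mathrm{gcol}(G)$.
   Context: All graphs are finite and simple. For a linear ordering $\tau$ of all vertices of $G=(V,E)$ and $v\in V$, let $N_G^+(\tau,v)$ be the set of neighbors $u$ of $v$ in $G$ with $u<_\tau v$, let $N_G^+[\tau,v]=N_G^+(\tau,v)\cup\{v\}$, and let $\mathrm{col}(G,\tau)=\max_{v\in V}|N_G^+[\tau,v]|$ (taken to be $0$ if $V=\emptyset$). A preordering of $G$ is a sequence $\sigma=(v_1,\dots,v_m)$ of distinct vertices of $G$, with $m\ge 0$ and underlying set $\mathrm{ra}(\sigma)=\{v_1,\dots,v_m\}$. In the $\sigma$-game on $G$, two players Alice and Bob alternately choose a not-yet-chosen vertex from $V\setminus \mathrm{ra}(\sigma)$ and append it to the end of the current sequence, starting from $\sigma$, until all vertices are listed, giving a linear ordering $\tau$ of $V$. The score is $\mathrm{col}(G,\tau)$; Alice tries to minimize it and Bob tries to maximize it. In the $\sigma$-game, Alice moves first if $m$ is even and Bob moves first if $m$ is odd. The $\sigma$-game coloring number $\sigma\text{-}\mathrm{gcol}(G)$ is the least $s$ such that Alice has a strategy guaranteeing a score of at most $s$ however Bob plays. The numbers $\sigma\text{-}\mathrm{gcol}_A(G)$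 and $\sigma\text{-}\mathrm{gcol}_B(G)$ are defined in the same way for the Alice $\sigma$-game and the Bob $\sigma$-game, in which Alice, respectively Bob, moves first regardless of the parity of $m$. *)

(* Defs.v *)
From mathcomp Require Import all_boot.
From mathcomp Require Import boolp.
Set Implicit Arguments.
Unset Strict Implicit.
Unset Printing Implicit Defensive.

(* A simple graph on the vertex type [T] is a symmetric and
   irreflexive relation [e : rel T]; a preordering is a duplicate-free sequence. *)

Definition linear_ordering (T : finType) (tau : seq T) : Prop :=
  uniq tau /\ forall v : T, v \in tau.

Definition Nplus (T : finType) (e : rel T) (tau : seq T) (v : T) : {set T} :=
  [set u | e v u && (index u tau < index v tau)].

Definition Nplus_closed (T : finType) (e : rel T) (tau : seq T) (v : T)
  : {set T} := v |: Nplus e tau v.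

Definition col (T : finType) (e : rel T) (tau : seq T) : nat :=
  \max_(v : T) #|Nplus_closed e tau v|.

Inductive player := Alice | Bob.

Definition opponent (p : player) : player :=
  match p with Alice => Bob | Bob => Alice end.

(* Who makes the [i]-th move (counted from 0), when [first] makes move 0. *)
Definition mover (first : player) (i : nat) : player :=
  if odd i then opponent first else first.

(* A strategy reads the whole current sequence, hence the full history of the
   game. The codomain is [option T] so that strategies exist when [T] is empty;
   legality forces a proper move wherever one exists, so that Alice cannot win
   by refusing to move. *)
Definition legal_strategy (T : finType) (f : seq T -> option T) : Prop :=
  forall p : seq T, (exists v, v \notin p) ->
    exists2 v, f p = Some v & v \notin p.

(* The possible outcomes of the game starting from [sigma] when [first] moves
   first, Alice follows [f], and Bob is unconstrained. *)
Definition outcome (T : finType) (sigma : seq T) (first : player)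
    (f : seq T -> option T) (tau : seq T) : Prop :=
  [/\ linear_ordering tau,
      prefix sigma tau
    & forall k, size sigma <= k < size tau ->
        mover first (k - size sigma) = Alice ->
        f (take k tau) = onth tau k].

Definition Alice_guarantees (T : finType) (e : rel T) (sigma : seq T)
    (first : player) (s : nat) : Prop :=
  exists2 f : seq T -> option T, legal_strategy f &
    forall tau, outcome sigma first f tau -> col e tau <= s.

Lemma Alice_guarantees_ex (T : finType) (e : rel T) (sigma : seq T)
    (first : player) : exists s, `[< Alice_guarantees e sigma first s >].
Proof.
exists #|T|; apply/asboolP; exists (fun p => [pick v | v \notin p]).
  move=> p [v vp]; case: pickP => [u up|/(_ v)]; last by rewrite vp.
  by exists u.
by move=> tau _; apply/bigmax_leqP => v _; apply: max_card.
Qed.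

Definition gcol_first (T : finType) (e : rel T) (sigma : seq T)
    (first : player) : nat :=
  ex_minn (Alice_guarantees_ex e sigma first).

Definition gcolA (T : finType) (e : rel T) (sigma : seq T) : nat :=
  gcol_first e sigma Alice.

Definition gcolB (T : finType) (e : rel T) (sigma : seq T) : nat :=
  gcol_first e sigma Bob.

Definition gcol (T : finType) (e : rel T) (sigma : seq T) : nat :=
  gcol_first e sigma (if odd (size sigma) then Bob else Alice).

(* Main.v *)
Require Import Defs.
From mathcomp Require Import all_boot.
From mathcomp Require Import boolp.

(** Moving first never hurts Alice: if she can hold the score to [s] when Bob
moves first, she can also do so when she moves first.  Both inequalities are
this fact, since the parity of [sigma] only decides which of the two games
[gcol] refers to.

Whether a score of [s] can be held from a given moment on depends only on the
set [C] of vertices chosen so far: choosing [v] costs one more than the number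
of neighbours of [v] in [C].  The predicate [wins e s C pl] says that Alice,
with [pl] to move at [C], can keep every further cost at most [s];
[guarantees_wins] and [wins_guarantees] link it to strategies on sequences.

The heart is [wins_pass].  Suppose Alice wins at [C] with Bob to move.  In any
completed play the last vertex sees all its neighbours before it, so, the play
being won, some unchosen vertex [u] has total degree less than [s]; such a
vertex is cheap whenever it is chosen.  Alice moves first by imagining that Bob
has just chosen [u] and giving her winning reply.  She continues in this way,
the imagined position being the real one plus [u].  Every vertex other than [u]
has at most as many chosen neighbours in reality as in her imagination, and
[u] is always cheap, so the real play is as good as the imagined one.  If Bob
really chooses [u], the two positions coincide, but with Alice to move in
reality and Bob in her imagination: this is the original situation with fewer
vertices left, and she starts again. *)

(** * The game on sets of chosen vertices *)

Definition chosen_nbrs {T : finType} (e : rel T) (C : {set T}) (v : T)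
  : {set T} := [set u in C | e v u].

Lemma chosen_nbrsS {T : finType} (e : rel T) (C D : {set T}) (v : T) :
  C \subset D -> #|chosen_nbrs e C v| <= #|chosen_nbrs e D v|.
Proof.
move=> sCD; apply/subset_leq_card/subsetP => u; rewrite !inE.
by case/andP => /(subsetP sCD) -> ->.
Qed.

(** Only Alice needs a constructor for the end of the game: with Bob to move,
[wins_Bob] applies vacuously there. *)
Inductive wins {T : finType} (e : rel T) (s : nat) : {set T} -> player -> Prop :=
| wins_over : wins e s setT Alice
| wins_Alice (C : {set T}) (v : T) :
    v \notin C -> #|chosen_nbrs e C v| < s -> wins e s (v |: C) Bob ->
    wins e s C Alice
| wins_Bob (C : {set T}) :
    (forall v, v \notin C -> #|chosen_nbrs e C v| < s) ->
    (forall v, v \notin C -> wins e s (v |: C) Alice) ->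
    wins e s C Bob.

(** The last vertex of a play that Alice wins is an example: all its neighbours
count when it is chosen. *)
Lemma wins_small_degree {T : finType} (e : rel T) (e_irr : irreflexive e)
    (s : nat) (C : {set T}) (pl : player) :
  wins e s C pl -> C != setT ->
  exists2 u, u \notin C & #|chosen_nbrs e setT u| < s.
Proof.
have step (D : {set T}) v : v \notin D -> #|chosen_nbrs e D v| < s ->
    (v |: D != setT ->
       exists2 u, u \notin v |: D & #|chosen_nbrs e setT u| < s) ->
    exists2 u, u \notin D & #|chosen_nbrs e setT u| < s.
  move=> vD dv IH; have [full|/IH [u]] := eqVneq (v |: D) setT; last first.
    by rewrite !inE negb_or => /andP [_ uD] du; exists u.
  (* The vertex [v] is the last one, so all its neighbours lie in [D]. *)
  exists v => //; apply: leq_ltn_trans dv; apply/subset_leq_card/subsetP => w.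
  rewrite !inE /= => vw; rewrite vw andbT.
  have: w \in v |: D by rewrite full inE.
  by rewrite !inE => /orP [/eqP wv|//]; rewrite wv e_irr in vw.
elim=> {C pl} [|C v vC dv _ IH _|C dC _ IH nfull].
- by rewrite eqxx.
- exact: step vC dv IH.
- have [v vC] : exists v, v \notin C.
    apply/existsP; rewrite -negb_forall; apply: contra nfull => /forallP inC.
    by apply/eqP/setP => x; rewrite inE inC.
  exact: step vC (dC v vC) (IH v vC).
Qed.

(** The two halves are proved together because each feeds the other: Alice's
first move comes from forgetting an imagined move of Bob at a vertex of small
degree, and when Bob really makes that move Alice is on turn in a position
that she was known to win with Bob on turn. *)
Lemma wins_pass_forget {T : finType} (e : rel T) (e_irr : irreflexive e)
    (s : nat) (C : {set T}) (pl : player) :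
  wins e s C pl ->
  (pl = Bob -> wins e s C Alice) /\
  (forall u, u \in C -> #|chosen_nbrs e setT u| < s -> wins e s (C :\ u) pl).
Proof.
have cheap (D : {set T}) u : #|chosen_nbrs e setT u| < s ->
    #|chosen_nbrs e D u| < s.
  by apply: leq_ltn_trans; apply/chosen_nbrsS/subsetT.
have cheaper (D : {set T}) u v : #|chosen_nbrs e D v| < s ->
    #|chosen_nbrs e (D :\ u) v| < s.
  by apply: leq_ltn_trans; apply/chosen_nbrsS/subD1set.
have setU1D1 (D : {set T}) u v : u \in D -> v \notin D ->
    v |: (D :\ u) = (v |: D) :\ u.
  move=> uD vD; apply/setP => x; rewrite !inE.
  by case: eqVneq => [->|]; case: eqVneq => // uv; rewrite -?uv ?uD // uv uD in vD.
elim=> {C pl} [|C v vC dv _ [_ IH]|C dC winC IH].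
- split=> // u _ du; apply: (@wins_Alice _ _ _ _ u).
  + by rewrite setD11.
  + exact: cheap.
  + by rewrite setD1K ?inE //; apply: wins_Bob => v; rewrite inE.
- split=> // u uC du; apply: (@wins_Alice _ _ _ _ v).
  + by rewrite !inE (negPf vC) andbF.
  + exact: cheaper.
  + by rewrite setU1D1 //; apply: IH => //; rewrite !inE uC orbT.
- have pass : wins e s C Alice.
    have [->|nfull] := eqVneq C setT; first exact: wins_over.
    have winBob : wins e s C Bob by apply: wins_Bob.
    have [u uC du] := wins_small_degree e e_irr s C Bob winBob nfull.
    have [_ /(_ u)] := IH u uC.
    by rewrite setU1K //; apply=> //; rewrite setU11.
  split=> // u uC du; apply: wins_Bob => v.
  + rewrite !inE negb_and negbK => /orP [/eqP ->|vC]; first exact: cheap.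
    by apply/cheaper/dC.
  + rewrite !inE negb_and negbK => /orP [/eqP ->|vC]; first by rewrite setD1K.
    rewrite setU1D1 //; have [_] := IH v vC; apply=> //.
    by rewrite !inE uC orbT.
Qed.

Lemma wins_pass {T : finType} (e : rel T) (e_irr : irreflexive e) (s : nat)
    (C : {set T}) :
  wins e s C Bob -> wins e s C Alice.
Proof. by case/(wins_pass_forget e e_irr) => + _; apply. Qed.

(** * From sequences to sets and back *)

Lemma mover_shift (pl : player) (p k : nat) :
  p < k -> mover pl (k - p) = mover (opponent pl) (k - p.+1).
Proof. by move=> pk; rewrite -subnSK // /mover /=; case: odd; case: pl. Qed.

(** This lets both translations below go through the game one move at a time,
although outcomes speak of whole plays. *)
Lemma outcome_rcons {T : finType} (f : seq T -> option T) (p : seq T) (v : T)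
    (pl : player) (tau : seq T) :
  prefix (rcons p v) tau ->
  outcome p pl f tau <->
  outcome (rcons p v) (opponent pl) f tau /\ (pl = Alice -> f p = Some v).
Proof.
case/prefixP => q ->; set tau' := rcons p v ++ q.
have szp : size p < size tau' by rewrite size_cat size_rcons leq_addr.
have takep : take (size p) tau' = p by rewrite /tau' cat_rcons take_size_cat.
have nthp : onth tau' (size p) = Some v.
  by rewrite /tau' cat_rcons onth_cat ltnn subnn.
split=> [[lin _ moves]|[[lin _ moves] movep]]; split=> //.
- split=> //; first exact: prefix_prefix.
  move=> k; rewrite size_rcons => /andP [pk ktau] mv.
  by apply: moves; rewrite ?(ltnW pk) // mover_shift.
- by move=> plA; rewrite -nthp -[in LHS]takep; apply: moves; rewrite ?leqnn ?subnn.
- by rewrite /tau' cat_rcons prefix_prefix.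
- move=> k /andP []; rewrite leq_eqVlt => /predU1P [<- _|pk ktau] mv.
    by rewrite takep nthp; apply: movep; rewrite subnn in mv.
  by apply: moves; rewrite size_rcons ?pk // -mover_shift.
Qed.

(** The part of [col e tau <= s] that is already decided once the prefix [p] of
[tau] has been chosen: the strict inequality accounts for [x] itself. *)
Definition cheap_so_far {T : finType} (e : rel T) (s : nat) (p : seq T) : Prop :=
  forall x, x \in p -> #|Nplus e p x| < s.

Lemma card_Nplus_closed {T : finType} (e : rel T) (p : seq T) (v : T) :
  #|Nplus_closed e p v| = #|Nplus e p v|.+1.
Proof. by rewrite cardsU1 inE ltnn andbF. Qed.

Lemma col_leP {T : finType} (e : rel T) (s : nat) (tau : seq T) :
  linear_ordering tau -> col e tau <= s <-> cheap_so_far e s tau.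
Proof.
case=> _ intau; split=> [/bigmax_leqP cs x _|cs].
  by rewrite -card_Nplus_closed; apply: cs.
by apply/bigmax_leqP => x _; rewrite card_Nplus_closed; apply: cs.
Qed.

Lemma cheap_so_far_rcons {T : finType} (e : rel T) (s : nat) (p : seq T)
    (v : T) :
  v \notin p ->
  cheap_so_far e s (rcons p v) <->
  cheap_so_far e s p /\ #|chosen_nbrs e [set x in p] v| < s.
Proof.
move=> vp.
have old x : x \in p -> Nplus e (rcons p v) x = Nplus e p x.
  move=> xp; apply/setP => u; rewrite !inE -cats1 !index_cat xp.
  case: ifPn => // up; rewrite (memNindex up) !ltnNge index_size.
  by rewrite (leq_trans (index_size _ _) (leq_addr _ _)).
have new : Nplus e (rcons p v) v = chosen_nbrs e [set x in p] v.
  apply/setP => u; rewrite !inE -cats1 !index_cat (negPf vp) /= eqxx addn0 andbC.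
  by case: ifPn => up; rewrite ?index_mem ?up // ltnNge leq_addr.
split=> [cs|[cs dv] x].
  split=> [x xp|]; first by rewrite -old //; apply: cs; rewrite mem_rcons inE xp orbT.
  by rewrite -new; apply: cs; rewrite mem_rcons inE eqxx.
by rewrite mem_rcons inE => /predU1P [->|xp]; [rewrite new|rewrite old //; apply: cs].
Qed.

Lemma set_rcons {T : finType} (p : seq T) (v : T) :
  [set x in rcons p v] = v |: [set x in p].
Proof. by apply/setP => x; rewrite !inE mem_rcons inE. Qed.

Lemma complete_or_extends {T : finType} (p : seq T) :
  (forall v, v \in p) \/ exists v, v \notin p.
Proof.
case: (boolP [forall v, v \in p]) => [/forallP|]; first by left.
by rewrite negb_forall => /existsP; right.
Qed.

(** One follows [f] in all plays at once; the conclusion includes the vertices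
of [p] because the cost of a vertex is read off from the conclusion for the
sequence that ends with it. *)
Lemma guarantees_wins {T : finType} (e : rel T) (s : nat)
    (f : seq T -> option T) (f_legal : legal_strategy f) (p : seq T)
    (pl : player) :
  uniq p -> (forall tau, outcome p pl f tau -> col e tau <= s) ->
  cheap_so_far e s p /\ wins e s [set x in p] pl.
Proof.
have [n] := ubnP (#|T| - size p); elim: n p pl => // n IH p pl le_n up guar.
have [full|[v0 v0p]] := complete_or_extends p.
  split; first apply/col_leP => //; first apply: guar.
  - split; [by split|exact: prefix_refl|move=> k].
    by case/andP => /leq_ltn_trans /[apply]; rewrite ltnn.
  - have -> : [set x in p] = setT by apply/setP => x; rewrite !inE full.
    case: pl {guar}; first exact: wins_over.
    by apply: wins_Bob => v; rewrite inE.
have next v : v \notin p -> (pl = Alice -> f p = Some v) ->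
    [/\ cheap_so_far e s p, #|chosen_nbrs e [set x in p] v| < s
      & wins e s (v |: [set x in p]) (opponent pl)].
  move=> vp fv; have upv : uniq (rcons p v) by rewrite rcons_uniq vp.
  have lt_p : size p < #|T|.
    by rewrite -(size_rcons p v) -(card_uniqP upv) max_card.
  have [||tau out|] := IH (rcons p v) (opponent pl) => //.
  - by rewrite -subnSK // ltnS -(size_rcons p v) in le_n.
  - apply: guar; apply/(@outcome_rcons _ _ _ v); last by split.
    by case: out.
  by rewrite set_rcons => /(cheap_so_far_rcons e s p v vp) [].
case: pl {IH guar} next => next.
- have [v fv vp] : exists2 v, f p = Some v & v \notin p.
    by apply: f_legal; exists v0.
  have [cs dv wv] := next v vp (fun _ => fv); split=> //.
  by apply: wins_Alice wv; rewrite ?inE.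
- have nextB v vp := next v vp (fun BA : Bob = Alice => ltac:(discriminate)).
  split; first by case: (nextB v0 v0p).
  by apply: wins_Bob => v; rewrite inE => /nextB [].
Qed.

(** A strategy need not remember the starting position, since being won is a
property of the current set: always choosing a vertex that is cheap now and
leaves a won position with Bob to move works from every winning position. *)
Lemma wins_strategy {T : finType} (e : rel T) (s : nat) :
  exists2 f : seq T -> option T, legal_strategy f &
    forall p, wins e s [set x in p] Alice -> (exists v, v \notin p) ->
      forall v, f p = Some v ->
        #|chosen_nbrs e [set x in p] v| < s /\
        wins e s (v |: [set x in p]) Bob.
Proof.
pose winning (p : seq T) v := [&& v \notin p, #|chosen_nbrs e [set x in p] v| < s
  & `[< wins e s (v |: [set x in p]) Bob >]].
exists (fun p => if [pick v | winning p v] is Some v then Some v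
                 else [pick v | v \notin p]).
  move=> p [v vp]; case: pickP => [w /andP [wp _]|_]; first by exists w.
  by case: pickP => [w wp|/(_ v)]; [exists w|rewrite vp].
move=> p winp [v0 v0p] v.
case: pickP => [w /and3P [_ dw /asboolP ww] [<-] //|none].
have [u] : exists u, winning p u.
  move EC: [set x in p] winp => C winp; move Epl: Alice winp => pl winp.
  case: winp Epl EC => [_ full|D w wD dw ww _ ED|//].
    by move/setP/(_ v0): full; rewrite !inE (negPf v0p).
  exists w; rewrite /winning ED dw; apply/andP; split.
    by move: wD; rewrite -ED inE.
  exact/asboolP.
by rewrite none.
Qed.

Lemma wins_guarantees {T : finType} (e : rel T) (s : nat) (p : seq T)
    (pl : player) :
  cheap_so_far e s p -> wins e s [set x in p] pl ->
  Alice_guarantees e p pl s.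
Proof.
have [f f_legal f_wins] := wins_strategy e s.
move=> cs win; exists f => // tau.
have [n] := ubnP (size tau - size p); elim: n p pl cs win => // n IH p pl cs win.
move=> le_n out; have [lin /prefixP [[|v q] tauE] _] := out.
  by apply/col_leP; rewrite // tauE cats0.
have pre : prefix (rcons p v) tau by rewrite tauE -cat_rcons prefix_prefix.
have [/(_ out) [out' fv] _] := outcome_rcons f p v pl tau pre.
have vp : v \notin p.
  case: lin => + _; rewrite tauE cat_uniq => /and3P [_ + _].
  by apply: contra => vp; apply/hasP; exists v; rewrite ?mem_head.
have [dv win'] : #|chosen_nbrs e [set x in p] v| < s /\
    wins e s (v |: [set x in p]) (opponent pl).
  case: pl win fv {out out'} => [win fv|win _].
    by apply: f_wins => //; [exists v|apply: fv].
  move Epl: Bob win => pl win.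
  move EC: [set x in p] win => C win.
  case: win Epl EC => // D dD wD _ ED.
  by split; [apply: dD|apply: wD]; rewrite -ED inE.
apply: (IH (rcons p v) (opponent pl)) => //.
- exact/cheap_so_far_rcons.
- by rewrite set_rcons.
- have lt_p : size p < size tau by rewrite tauE size_cat /= addnS ltnS leq_addr.
  by rewrite -subnSK // ltnS -(size_rcons p v) in le_n.
Qed.

Lemma gcol_first_Alice_le_Bob {T : finType} (e : rel T)
    (e_irr : irreflexive e) (sigma : seq T) :
  uniq sigma -> gcol_first e sigma Alice <= gcol_first e sigma Bob.
Proof.
move=> sigma_uniq; rewrite /gcol_first.
case: ex_minnP => a _ min_a; case: ex_minnP => b /asboolP [f f_legal guar] _.
apply/min_a/asboolP.
have [cs win] := guarantees_wins e b f f_legal sigma Bob sigma_uniq guar.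
by apply: wins_guarantees cs _; apply: wins_pass.
Qed.

Theorem theorem3 (T : finType) (e : rel T) (e_sym : symmetric e)
    (e_irr : irreflexive e) (sigma : seq T) (sigma_uniq : uniq sigma) :
  (~~ odd (size sigma) -> gcol e sigma <= gcolB e sigma) /\
  (odd (size sigma) -> gcolA e sigma <= gcol e sigma).
Proof.
have le_AB := gcol_first_Alice_le_Bob e e_irr sigma sigma_uniq.
by split=> parity; rewrite /gcol ?(negPf parity) ?parity.
Qed.
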